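(* Let $\mathcal{P}=(|K|,V_{\mathcal{P}})$ be a polyhedral model and $\mathbb{F}(\mathcal{P})$ its cell poset model. For every point $x\in|K|$ and every $\mathrm{SLCS}_\eta$ formula $\Phi$: $\mathcal{P},x\models\Phi$ if and only if $\mathbb{F}(\mathcal{P}),\mathbb{F}(x)\models\Phi$.
   Context: A simplex $\sigma\subseteq\mathbb{R}^m$ is the convex hull of finitely many affinely independent points $v_0,\dots,v_d$; its faces are the simplexes spanned by subsets of these points, and its relative interior (a ''cell'') $\widetilde{\sigma}$ is the set of points $\sum\lambda_iv_i$ with all $\lambda_i\in(0,1]$, $\sum\lambda_i=1$. A simplicial complex $K$ is a finite set of simplexes closed under taking faces and such that any two of its simplexes intersect in a common face (or not at all). $|K|$ is the union of its simplexes with the subspace topology of $\mathbb{R}^m$; the cells $\widetilde{K}=\{\widetilde\sigma:\sigma\in K\}$ partition $|K|$, and they are partially ordered by $\widetilde{\sigma_1}\preccurlyeq\widetilde{\sigma_2}$ iff $\sigma_1$ is a face of $\sigma_2$ (equivalently $\widetilde{\sigma_1}$ is contained in the topological closure of $\widetilde{\sigma_2}$). Fix a set $PL$ of proposition letters. A polyhedral model is $\mathcal{P}=(|K|,V_{\mathcal{P}})$ with $V_{\mathcal{P}}:PL\to 2^{|K|}$ such that each $V_{\mathcal{P}}(p)$ is a union of cells. Its cell poset model is $\mathbb{F}(\mathcal{P})=(\widetilde K,\preccurlyeq,V_{\mathbb{F}})$ with $\widetilde\sigma\in V_{\mathbb{F}}(p)$ iff $\widetilde\sigma\subseteq V_{\mathcal{P}}(p)$;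 $\mathbb{F}(x)$ denotes the unique cell containing $x$. A topological path from $x$ is a continuous $\pi:[0,1]\to|K|$ with $\pi(0)=x$. For a poset $(W,\preccurlyeq)$, a $\pm$-path of length $\ell\ge2$ is $\pi:\{0,\dots,\ell\}\to W$ such that for each $i<\ell$, $\pi(i)\preccurlyeq\pi(i+1)$ or $\pi(i+1)\preccurlyeq\pi(i)$, and moreover $\pi(0)\preccurlyeq\pi(1)$ and $\pi(\ell)\preccurlyeq\pi(\ell-1)$. $\mathrm{SLCS}_\eta$ formulas: $\Phi::=p\mid\neg\Phi\mid\Phi_1\wedge\Phi_2\mid\eta(\Phi_1,\Phi_2)$ with $p\in PL$. On a polyhedral model: $x\models p$ iff $x\in V_{\mathcal{P}}(p)$, Boolean connectives as usual, and $x\models\eta(\Phi_1,\Phi_2)$ iff there is a topological path $\pi$ from $x$ with $\pi(1)\models\Phi_2$ and $\pi(r)\models\Phi_1$ for all $r\in[0,1)$. On a poset (or Kripke) model $(W,\preccurlyeq,V)$: $w\models p$ iff $w\in V(p)$, Boolean connectives as usual, and $w\models\eta(\Phi_1,\Phi_2)$ iff there is a $\pm$-path $\pi$ of some length $\ell$ with $\pi(0)=w$, $\pi(\ell)\models\Phi_2$ and $\pi(i)\models\Phi_1$ for all $i\in\{0,\dots,\ell-1\}$. *)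

(* Defs.v *)
From HB Require Import structures.
From mathcomp Require Import all_boot all_order all_algebra finmap.
From mathcomp Require Import all_classical all_reals all_analysis.
Set Implicit Arguments.
Unset Strict Implicit.
Unset Printing Implicit Defensive.
Import Order.TTheory GRing.Theory Num.Theory.
Import numFieldNormedType.Exports.
Local Open Scope classical_set_scope.
Local Open Scope ring_scope.

Section Simplexes.
Variables (R : realType) (m : nat).
Implicit Types (A B : {fset 'rV[R]_m}) (x v : 'rV[R]_m).

Definition affinely_independent A : Prop :=
  forall l : 'rV[R]_m -> R,
    \sum_(v <- A) l v = 0 -> \sum_(v <- A) l v *: v = 0 ->
    forall v, v \in A -> l v = 0.

(* A simplex is handled through its set A of vertices; as a subset of R^m it is
   hull A, which determines A by hull_inj below. *)
Definition is_simplex A : Prop := A != fset0 /\ affinely_independent A.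

Definition hull A : set 'rV[R]_m :=
  [set x | exists l : 'rV[R]_m -> R,
     [/\ forall v, v \in A -> 0 <= l v,
         \sum_(v <- A) l v = 1 & x = \sum_(v <- A) l v *: v]].

Definition cell A : set 'rV[R]_m :=
  [set x | exists l : 'rV[R]_m -> R,
     [/\ forall v, v \in A -> 0 < l v <= 1,
         \sum_(v <- A) l v = 1 & x = \sum_(v <- A) l v *: v]].

Definition face A B : Prop := A != fset0 /\ (A `<=` B)%fset.

Lemma affinely_independent_inj A (l k : 'rV[R]_m -> R) :
  affinely_independent A ->
  \sum_(v <- A) l v = \sum_(v <- A) k v ->
  \sum_(v <- A) l v *: v = \sum_(v <- A) k v *: v ->
  forall v, v \in A -> l v = k v.
Proof.
move=> indA e1 e2 v vA; apply/eqP; rewrite -subr_eq0; apply/eqP.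
apply: (indA (fun v => l v - k v)) vA; first by rewrite sumrB e1 subrr.
by under eq_bigr do rewrite scalerBl; rewrite sumrB e2 subrr.
Qed.

Lemma fset_sum_extend (U : zmodType) A B (F : 'rV[R]_m -> U) :
  (A `<=` B)%fset ->
  \sum_(v <- A) F v = \sum_(v <- B) (if v \in A then F v else 0).
Proof.
move=> AB; rewrite -(big_fset_incl _ AB); last by move=> v _ /negbTE ->.
by apply: eq_big_seq => v ->.
Qed.

Lemma fset_comb_extend A B (l : 'rV[R]_m -> R) :
  (A `<=` B)%fset ->
  \sum_(v <- A) l v *: v = \sum_(v <- B) (if v \in A then l v else 0) *: v.
Proof.
move=> AB; rewrite (fset_sum_extend _ AB).
by apply: eq_bigr => v _; case: ifP => // _; rewrite scale0r.
Qed.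

Lemma weight_le1 A (l : 'rV[R]_m -> R) :
  (forall v, v \in A -> 0 <= l v) -> \sum_(v <- A) l v = 1 ->
  forall v, v \in A -> l v <= 1.
Proof.
move=> l0 l1 v vA; rewrite -l1 (big_fsetD1 v vA) /= lerDl big_seq.
by apply: sumr_ge0 => w; rewrite !inE => /andP[_ /l0].
Qed.

Lemma weights_neq0 A (l : 'rV[R]_m -> R) :
  \sum_(v <- A) l v = 1 -> A != fset0.
Proof.
move=> l1; apply/eqP => A0; move: l1; rewrite A0 big_seq_fset0 => /esym /eqP.
by rewrite oner_eq0.
Qed.

Lemma hull_cell A x : hull A x -> exists2 B, face B A & cell B x.
Proof.
move=> [l [l0 l1 ->]]; pose B := [fset v in A | l v != 0]%fset.
have BA : (B `<=` A)%fset by apply/fsubsetP => v; rewrite !inE => /andP[].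
have lB v : v \in A -> v \notin B -> l v = 0.
  by move=> vA; rewrite !inE vA /= negbK => /eqP.
have sB : \sum_(v <- B) l v = 1 by rewrite -l1; exact: big_fset_incl.
exists B; first by split=> //; exact: weights_neq0 sB.
exists l; split=> //.
  move=> v; rewrite !inE => /andP[vA lv]; rewrite lt0r lv l0 //=.
  exact: weight_le1 vA.
apply/esym/big_fset_incl => // v vA vB; by rewrite lB // scale0r.
Qed.

Lemma cell_sub_hull A : cell A `<=` hull A.
Proof.
by move=> x [l [l0 l1 ->]]; exists l; split=> // v /l0 /andP[/ltW].
Qed.

Lemma cell_nonempty A : A != fset0 -> cell A !=set0.
Proof.
move=> A0; have c0 : (0 < #|` A|)%N by rewrite cardfs_gt0.
have s1 : \sum_(v <- A) (#|` A|%:R^-1 : R) = 1.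
  rewrite big_const_seq count_predT iter_addr_0 -[LHS]mulr_natr.
  by rewrite mulVf // pnatr_eq0 -lt0n.
exists (\sum_(v <- A) #|` A|%:R^-1 *: v), (fun=> #|` A|%:R^-1); split=> //.
move=> v _; rewrite invr_gt0 ltr0n c0 /= invf_le1 ?ltr0n //.
by rewrite ler1n.
Qed.

Lemma vertex_in_hull A v : v \in A -> hull A v.
Proof.
move=> vA; exists (fun w => (w == v)%:R); split=> [w _||]; first exact: ler0n.
  rewrite (big_fsetD1 v vA) /= eqxx big_seq big1 ?addr0 // => w.
  by rewrite !inE => /andP[/negbTE ->].
rewrite (big_fsetD1 v vA) /= eqxx scale1r big_seq big1 ?addr0 // => w.
by rewrite !inE => /andP[/negbTE ->]; rewrite scale0r.
Qed.

Lemma hull_inj A B : affinely_independent A -> affinely_independent B ->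
  hull A = hull B -> A = B.
Proof.
wlog suff sub : A B / affinely_independent A -> affinely_independent B ->
    hull A = hull B -> (A `<=` B)%fset.
  move=> iA iB e; apply/eqP; rewrite eqEfsubset.
  by rewrite (sub A B) //= (sub B A).
move=> iA iB e; apply/fsubsetP => a aA.
have [mu [mu0 mu1 mua]] : hull B a by rewrite -e; exact: vertex_in_hull.
have /choice[L HL] : forall b, exists l : 'rV[R]_m -> R, b \in B ->
    [/\ forall v, v \in A -> 0 <= l v,
        \sum_(v <- A) l v = 1 & b = \sum_(v <- A) l v *: v].
  move=> b; have [bB|] := boolP (b \in B); last by exists (fun=> 0).
  have : hull A b by rewrite e; exact: vertex_in_hull.
  by move=> [l ?]; exists l.
pose nu v := \sum_(b <- B) mu b * L b v.
have sumnu : \sum_(v <- A) nu v = 1.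
  rewrite exchange_big /= -[RHS]mu1; apply: eq_big_seq => b bB.
  by rewrite -mulr_sumr; have [_ -> _] := HL b bB; rewrite mulr1.
have combnu : \sum_(v <- A) nu v *: v = a.
  rewrite [RHS]mua; under eq_bigr do rewrite scaler_suml.
  rewrite exchange_big /=; apply: eq_big_seq => b bB.
  have [_ _ eb] := HL b bB; transitivity (mu b *: \sum_(v <- A) L b v *: v).
    by rewrite scaler_sumr; apply: eq_bigr => v _; rewrite scalerA.
  by rewrite -eb.
have nuE v : v \in A -> nu v = (v == a)%:R.
  apply: (affinely_independent_inj iA (k := fun v => (v == a)%:R)).
    rewrite sumnu (big_fsetD1 a aA) /= eqxx big_seq big1 ?addr0 // => w.
    by rewrite !inE => /andP[/negbTE ->].
  rewrite combnu (big_fsetD1 a aA) /= eqxx scale1r big_seq big1 ?addr0 // => w.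
  by rewrite !inE => /andP[/negbTE ->]; rewrite scale0r.
have [b bB mub] : exists2 b, b \in B & mu b != 0.
  apply: contrapT => /forall2NP h; move: mu1; rewrite big_seq big1.
    by move/esym/eqP; rewrite oner_eq0.
  by move=> b bB; case: (h b) => [/(_ bB)//|/negP]; rewrite negbK => /eqP.
have Lb0 v : v \in A -> v != a -> L b v = 0.
  move=> vA va; have := nuE v vA; rewrite (negbTE va) /nu => /eqP.
  rewrite big_seq psumr_eq0; last first.
    by move=> c cB; rewrite mulr_ge0 ?mu0 //; have [h _ _] := HL c cB; exact: h.
  move=> /allP/(_ b bB); rewrite bB /= mulf_eq0 (negbTE mub) /=.
  by move/eqP.
have [_ Lb1 Lbb] := HL b bB.
have Laa : L b a = 1.
  rewrite -Lb1 (big_fsetD1 a aA) /= big_seq big1 ?addr0 // => w.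
  by rewrite !inE => /andP[wa wA]; exact: Lb0.
suff -> : a = b by [].
rewrite Lbb (big_fsetD1 a aA) /= Laa scale1r big_seq big1 ?addr0 // => w.
by rewrite !inE => /andP[wa wA]; rewrite Lb0 // scale0r.
Qed.

Record simplicial_complex := SimplicialComplex {
  simplexes :> set {fset 'rV[R]_m};
  simplexes_finite : finite_set simplexes;
  simplexesP : forall A, simplexes A -> is_simplex A;
  simplexes_face : forall A B, simplexes B -> face A B -> simplexes A;
  simplexes_meet : forall A B, simplexes A -> simplexes B ->
    hull A `&` hull B = set0 \/
    exists C, [/\ face C A, face C B & hull A `&` hull B = hull C]
}.

Implicit Types K : simplicial_complex.

(* |K|; as a type it carries the library's subspace topology on set_type. *)
Definition polyhedron K : set 'rV[R]_m := \bigcup_(A in simplexes K) hull A.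

Definition cells K : set (set 'rV[R]_m) := [set cell A | A in simplexes K].

Lemma cell_inj K A B x : simplexes K A -> simplexes K B ->
  cell A x -> cell B x -> A = B.
Proof.
move=> KA KB Ax Bx.
have [I0|[C [[C0 CA] [_ CB] IC]]] := simplexes_meet KA KB.
  have : (hull A `&` hull B) x by split; exact: cell_sub_hull.
  by rewrite I0.
have [k [k0 k1 xk]] : hull C x by rewrite -IC; split; exact: cell_sub_hull.
have full D : simplexes K D -> (C `<=` D)%fset -> cell D x -> D = C.
  move=> KD CD [l [l0 l1 xl]]; apply/eqP; rewrite eqEfsubset CD andbT.
  apply/fsubsetP => v vD; apply: contraT => vC.
  have [_ indD] := simplexesP KD.
  have := affinely_independent_inj (l := l)
    (k := fun v => if v \in C then k v else 0) indD _ _ vD.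
  rewrite -fset_sum_extend // -fset_comb_extend // l1 k1 -xl -xk (negbTE vC).
  by move=> /(_ erefl erefl) lv; have := l0 v vD; rewrite lv ltxx.
by rewrite (full A) // (full B).
Qed.

Lemma cell_of_exists K (x : polyhedron K) :
  exists! c : cells K, set_val c (set_val x).
Proof.
have [A KA Ax] := set_valP x.
have [B BA Bx] := hull_cell Ax.
have KB : simplexes K B by exact: simplexes_face BA.
have cB : cells K (cell B) by exists B.
exists (SigSub (mem_set cB)); split; first by rewrite set_valE.
move=> c cx; apply: val_inj => /=.
have [D KD cD] := set_valP c.
move: cx; rewrite -[set_val c]cD => Dx.
by rewrite -cD (cell_inj KB KD Bx Dx).
Qed.

Definition cell_of K (x : polyhedron K) : cells K := projT1 (cid (cell_of_exists x)).

Lemma cell_ofP K (x : polyhedron K) (c : cells K) :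
  cell_of x = c <-> set_val c (set_val x).
Proof.
rewrite /cell_of; case: cid => d /= [dx dU]; split=> [<-//|]; exact: dU.
Qed.

Definition cell_le K (c d : cells K) : Prop :=
  exists A B, [/\ simplexes K A, simplexes K B, set_val c = cell A,
                  set_val d = cell B & face A B].

Lemma cell_eq_inj K A B : simplexes K A -> simplexes K B ->
  cell A = cell B -> A = B.
Proof.
move=> KA KB AB; have [A0 _] := simplexesP KA.
have [x Ax] := cell_nonempty A0; apply: (cell_inj KA KB Ax); by rewrite -AB.
Qed.

Lemma cell_le_refl K (c : cells K) : cell_le c c.
Proof.
have [A KA cA] := set_valP c; exists A, A; split=> //.
by split=> //; have [] := simplexesP KA.
Qed.

Lemma cell_le_anti K (c d : cells K) : cell_le c d -> cell_le d c -> c = d.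
Proof.
move=> [A [B [KA KB cA dB [_ AB]]]] [B' [A' [KB' KA' dB' cA' [_ BA]]]].
have eA : A = A' by apply: (cell_eq_inj KA KA'); rewrite -cA.
have eB : B = B' by apply: (cell_eq_inj KB KB'); rewrite -dB.
subst A' B'; have /eqP eAB : A == B by rewrite eqEfsubset AB.
by apply: val_inj; rewrite -!set_valE cA dB eAB.
Qed.

Lemma cell_le_trans K (c d e : cells K) :
  cell_le c d -> cell_le d e -> cell_le c e.
Proof.
move=> [A [B [KA KB cA dB [A0 AB]]]] [B' [C [KB' KC dB' eC [_ BC]]]].
have eB : B = B' by apply: (cell_eq_inj KB KB'); rewrite -dB.
subst B'; exists A, C; split=> //; split=> //; exact: fsubset_trans BC.
Qed.

End Simplexes.

Inductive formula (PL : Type) : Type :=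
| Atom of PL
| Neg of formula PL
| And of formula PL & formula PL
| Eta of formula PL & formula PL.

Record polyhedral_model (R : realType) (m : nat) (PL : Type) :=
  PolyhedralModel {
    pm_complex :> simplicial_complex R m;
    pm_val : PL -> set 'rV[R]_m;
    pm_valP : forall p, exists2 C, C `<=` cells pm_complex &
      pm_val p = \bigcup_(c in C) c
  }.

Record poset_model (PL : Type) := PosetModel {
  world :> Type;
  wle : world -> world -> Prop;
  wle_refl : forall w, wle w w;
  wle_anti : forall v w, wle v w -> wle w v -> v = w;
  wle_trans : forall u v w, wle u v -> wle v w -> wle u w;
  wval : PL -> set world
}.

Definition cell_poset_model (R : realType) (m : nat) (PL : Type)
    (P : polyhedral_model R m PL) : poset_model PL :=
  @PosetModel PL (cells P) (@cell_le R m P)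
    (@cell_le_refl R m P) (@cell_le_anti R m P) (@cell_le_trans R m P)
    (fun p => [set c | set_val c `<=` pm_val P p]).

(* Only the values of pi on [0, 1] matter. *)
Definition topological_path (R : realType) (m : nat)
    (K : simplicial_complex R m) (x : polyhedron K) (pi : R -> polyhedron K) :=
  {within `[0, 1], continuous pi} /\ pi 0 = x.

(* Only the values of pi on {0, ..., l} matter. *)
Definition pm_path (PL : Type) (M : poset_model PL) (l : nat) (pi : nat -> M) :=
  [/\ (2 <= l)%N,
      forall i, (i < l)%N -> wle (pi i) (pi i.+1) \/ wle (pi i.+1) (pi i),
      wle (pi 0%N) (pi 1%N) &
      wle (pi l) (pi l.-1)].

Fixpoint psat (R : realType) (m : nat) (PL : Type)
    (P : polyhedral_model R m PL) (x : polyhedron P) (f : formula PL) : Prop :=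
  match f with
  | Atom p => pm_val P p (set_val x)
  | Neg g => ~ psat x g
  | And g h => psat x g /\ psat x h
  | Eta g h => exists pi : R -> polyhedron P,
      [/\ topological_path x pi, psat (pi 1) h &
          forall r, 0 <= r < 1 -> psat (pi r) g]
  end.

Fixpoint wsat (PL : Type) (M : poset_model PL) (w : M) (f : formula PL) : Prop :=
  match f with
  | Atom p => wval p w
  | Neg g => ~ wsat w g
  | And g h => wsat w g /\ wsat w h
  | Eta g h => exists (l : nat) (pi : nat -> M),
      [/\ pm_path l pi, pi 0%N = w, wsat (pi l) h &
          forall i, (i < l)%N -> wsat (pi i) g]
  end.

(* Main.v *)
Require Import Defs.
From mathcomp Require Import all_boot all_order all_algebra finmap.
From mathcomp Require Import all_classical all_reals all_analysis.
From mathcomp Require Import lra.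
Set Implicit Arguments.
Unset Strict Implicit.
Unset Printing Implicit Defensive.
Import Order.TTheory GRing.Theory Num.Theory.
Import numFieldNormedType.Exports.
Local Open Scope classical_set_scope.
Local Open Scope ring_scope.

(** Induction on the formula; only eta needs an argument.  A pm-path is the same
as a zigzag of comparable cells satisfying the first formula, followed by one
step down.  Simplexes being closed and finitely many, every point y has a
neighbourhood whose points lie in cells above the cell of y; hence the cells met
by a topological path on [0, 1) are all joined to the first one by zigzags, by
connectedness of [0, 1), and the last cell lies below the cells met shortly
before time 1.  Conversely, the half-open segment from a point of a cell to a
point of a face, or of a coface without its starting point, stays in the larger
cell, and a topological path is obtained by concatenating segments. *)

(** * Compactness of convex hulls of finite sets *)

Lemma hull_fset0 (R : realType) (m : nat) :
  hull (fset0 : {fset 'rV[R]_m}) = set0.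
Proof.
by apply/seteqP; split=> // x [l [_ /weights_neq0]]; rewrite eqxx.
Qed.

Lemma hull_fsetU1 (R : realType) (m : nat) (v : 'rV[R]_m)
    (A : {fset 'rV[R]_m}) : v \notin A ->
  hull (v |` A)%fset =
  [set v] `|` (fun p : R * 'rV[R]_m => p.1 *: v + (1 - p.1) *: p.2) @`
                (`[0, 1] `*` hull A).
Proof.
move=> vA; have ne w : w \in A -> (w == v) = false.
  by move=> wA; apply: contraNF vA => /eqP <-.
apply/seteqP; split=> x.
- move=> [l [l0]]; rewrite !big_fsetU1 //= => l1 ->.
  have l0A w : w \in A -> 0 <= l w by move=> wA; apply: l0; rewrite !inE wA orbT.
  have lv0 : 0 <= l v by apply: l0; rewrite !inE eqxx.
  have sA : \sum_(w <- A) l w = 1 - l v by lra.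
  (* If [l v] is 1, the other weights vanish and the point is the apex; otherwise they are divided
     by their sum [1 - l v]. *)
  have [lv1|lv1] := eqVneq (l v) 1; [left|right].
    have sA0 w : w \in A -> l w = 0.
      have : \sum_(w <- A) l w == 0 by rewrite sA lv1 subrr.
      rewrite big_seq psumr_eq0 // => /allP h wA.
      by have := h w wA; rewrite wA => /eqP.
    rewrite /= lv1 scale1r big_seq big1 ?addr0 // => w /sA0 ->.
    by rewrite scale0r.
  have d0 : 1 - l v != 0 by rewrite subr_eq0 eq_sym.
  have sA0 : 0 <= \sum_(w <- A) l w by rewrite big_seq; exact: sumr_ge0.
  exists (l v, \sum_(w <- A) (l w / (1 - l v)) *: w); last first.
    rewrite /= scaler_sumr; congr (_ + _); apply: eq_bigr => w _.
    by rewrite scalerA mulrC divfK.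
  split; first by rewrite /= in_itv /= lv0; lra.
  exists (fun w => l w / (1 - l v)); split=> // [w wA|].
    by rewrite divr_ge0 ?l0A // -sA.
  by rewrite -mulr_suml sA divff.
- case=> [->|[[t y] [/= + [l [l0 l1 ->]]] <-]].
    by apply: vertex_in_hull; rewrite !inE eqxx.
  rewrite in_itv /= => /andP[t0 t1].
  exists (fun w => if w == v then t else (1 - t) * l w); split.
  + move=> w; rewrite !inE; case: eqP => //= _ wA.
    by rewrite mulr_ge0 ?l0 ?subr_ge0.
  + rewrite big_fsetU1 //= eqxx.
    under eq_big_seq => w /ne -> do [].
    by rewrite -mulr_sumr l1; lra.
  + rewrite big_fsetU1 //= eqxx scaler_sumr; congr (_ + _).
    by apply: eq_big_seq => w /ne ->; rewrite scalerA.
Qed.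

Lemma compact_hull (R : realType) (m : nat) (A : {fset 'rV[R]_m}) :
  compact (hull A).
Proof.
elim/fset1U_rect: A => [|v A vA IH].
  by rewrite hull_fset0; exact: compact0.
rewrite hull_fsetU1 //; apply: compactU; first exact: compact_set1.
apply: continuous_compact; last exact: compact_setX (@segment_compact R 0 1) IH.
apply: continuous_subspaceT => p; apply: cvgD; apply: cvgZ.
- exact: cvg_fst.
- exact: cvg_cst.
- by apply: cvgB; [exact: cvg_cst | exact: cvg_fst].
- exact: cvg_snd.
Qed.

Lemma closed_hull (R : realType) (m : nat) (A : {fset 'rV[R]_m}) :
  closed (hull A).
Proof.
exact: (compact_closed (@norm_hausdorff R _) (@compact_hull R m A)).
Qed.

(** * Cells near a given point *)

Lemma cell_of_cell (R : realType) (m : nat) (K : simplicial_complex R m)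
    (x : polyhedron K) :
  exists A, [/\ simplexes K A, set_val (cell_of x) = cell A & cell A (set_val x)].
Proof.
have [A KA cA] := set_valP (cell_of x).
by exists A; split=> //; rewrite cA; apply/cell_ofP.
Qed.

(* Points outside the closed union of the simplexes that miss y form an open
   neighbourhood of y, and a simplex through y has the cell of y as a face. *)
Lemma near_cell_le (R : realType) (m : nat) (K : simplicial_complex R m)
    (y : polyhedron K) :
  \forall z \near y, cell_le (cell_of y) (cell_of z).
Proof.
pose far := [set A | simplexes K A /\ ~ hull A (set_val y)].
have cF : closed (\bigcup_(A in far) hull A).
  apply: closed_bigcup => [|A _]; last exact: closed_hull.
  by apply: sub_finite_set (simplexes_finite K) => A [].
have nF : nbhs (set_val y) (~` \bigcup_(A in far) hull A).
  by apply: open_nbhs_nbhs; split; [exact: closed_openC | move=> [A []]].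
have : nbhs y (set_val @^-1` ~` \bigcup_(A in far) hull A).
  exact: (@initial_continuous _ _ (set_val : polyhedron K -> _) y _ nF).
apply: filterS => z zF; have [A [KA cA Az]] := cell_of_cell z.
have Ay : hull A (set_val y).
  by apply: contrapT => nAy; apply: zF; exists A => //; exact: cell_sub_hull.
have [B BA By] := hull_cell Ay; have KB := simplexes_face KA BA.
have [C [KC cC Cy]] := cell_of_cell y.
by exists B, A; split=> //; rewrite cC (cell_inj KC KB Cy By).
Qed.

(** * Segments and concatenation of paths *)

(** After extending the weights of [a] by 0 to [B], each mixed weight is at least [t * l v], which
    is positive. *)
Lemma cell_segment (R : realType) (m : nat) (A B : {fset 'rV[R]_m})
    (a b : 'rV[R]_m) (t : R) :
  (A `<=` B)%fset -> cell A a -> cell B b -> 0 < t <= 1 ->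
  cell B ((1 - t) *: a + t *: b).
Proof.
move=> AB [k [k0 k1 ->]] [l [l0 l1 ->]] /andP[t0 t1].
pose n v := (1 - t) * (if v \in A then k v else 0) + t * l v.
have n0 v : v \in B -> 0 < n v.
  move=> /l0 /andP[lv _]; rewrite ltr_wpDl ?mulr_gt0 //.
  rewrite mulr_ge0 ?subr_ge0 //.
  by case: ifP => // /k0 /andP[/ltW].
have n1 : \sum_(v <- B) n v = 1.
  by rewrite big_split /= -!mulr_sumr -fset_sum_extend // k1 l1; lra.
exists n; split=> // [v vB|].
  by rewrite n0 //= (weight_le1 _ n1 vB) // => w /n0 /ltW.
rewrite (fset_comb_extend _ AB) !scaler_sumr -big_split /=.
by apply: eq_bigr => v _; rewrite !scalerA -scalerDl.
Qed.

(** As in the semantics of eta, time 1 is exempt from [G]. *)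
Definition linked (R : realType) (T : topologicalType) (G : set T) (x y : T) :=
  exists p : R -> T, [/\ {within `[0, 1], continuous p}, p 0 = x, p 1 = y &
    forall r, 0 <= r < 1 -> G (p r)].

Lemma linked_trans (R : realType) (T : topologicalType) (G : set T)
    (x y z : T) : linked R G x y -> linked R G y z -> linked R G x z.
Proof.
move=> [p [cp p0 p1 Gp]] [q [cq q0 q1 Gq]].
pose pq t := if t <= 2^-1 then p (2 * t) else q (2 * t - 1).
(* Reparametrization: [h] agrees on [a, b] with [f] after a continuous [u] mapping [a, b] into
   [0, 1]. *)
have comp (f h : R -> T) (u : R -> R) (a b : R) : continuous u ->
    {within `[0, 1], continuous f} ->
    (forall t, a <= t <= b -> 0 <= u t <= 1 /\ f (u t) = h t) ->
    {within `[a, b], continuous h}.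
  move=> cu cf fh.
  apply: (@subspace_eq_continuous _ _ _ (f \o u : subspace `[a, b] -> T)).
    by move=> t; rewrite inE /= in_itv /= => /fh[].
  apply/subspace_continuousP => t /=; rewrite in_itv /= => tab.
  have /subspace_continuousP/(_ (u t)) lim := cf.
  apply: (@cvg_comp _ _ _ u f _ (within `[0, 1] (nbhs (u t)))).
    move=> V wV; have {wV} := cu t _ wV.
    apply: (@filterS _ _ (nbhs_filter t)) => s us.
    rewrite /= in_itv /= => sab; apply: us.
    by rewrite /= in_itv /=; have [] := fh s sab.
  by apply: lim; rewrite /= in_itv /=; have [] := fh t tab.
exists pq; split.
- have -> : `[0, 1]%classic = `[0, 2^-1] `|` `[2^-1, 1] :> set R.
    apply/seteqP; split=> t /=; rewrite !in_itv /=.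
      by move=> /andP[t0 t1]; have [?|/ltW ?] := leP t 2^-1; [left|right];
         apply/andP.
    by case=> /andP[? ?]; apply/andP; lra.
  apply: withinU_continuous; try exact: interval_closed.
  + apply: (comp _ _ ( *%R 2)) cp _; first exact: mulrl_continuous.
    by move=> t /andP[t0 t1]; rewrite /pq t1; split=> //; lra.
  + apply: (comp _ _ (fun t => 2 * t - 1)) cq _.
      move=> t; apply: cvgB; last exact: cvg_cst.
      exact: (@mulrl_continuous R 2 t).
    move=> t /andP[t0 t1]; split; first lra.
    rewrite /pq; case: leP => // t2.
    have -> : t = 2^-1 by lra.
    by rewrite mulfV // subrr q0 p1.
- by rewrite /pq mulr0 p0 ifT // invr_ge0.
- have h2 : (1 <= 2^-1 :> R) = false by apply/negbTE; rewrite -ltNge; lra.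
  by rewrite /pq h2 mulr1 -[2]/(1 + 1) addrK.
- move=> r /andP[r0 r1]; rewrite /pq; case: leP => r2.
    (* At the junction [G] comes from the start of [q], since [p] guarantees nothing at time 1. *)
    have [->|r3] := eqVneq r 2^-1.
      by rewrite mulfV // p1 -q0; apply: Gq; lra.
    by apply: Gp; lra.
  by apply: Gq; lra.
Qed.

Lemma linked_segment (R : realType) (m : nat) (S : set 'rV[R]_m) (G : set S)
    (x y : S) :
  (forall t, 0 <= t < 1 -> exists2 z, G z &
    set_val z = (1 - t) *: set_val x + t *: set_val y) ->
  linked R G x y.
Proof.
move=> h; pose f (t : R) := (1 - t) *: set_val x + t *: set_val y.
have f0 : f 0 = set_val x by rewrite /f subr0 scale1r scale0r addr0.
have f1 : f 1 = set_val y by rewrite /f subrr scale1r scale0r add0r.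
have fS t : 0 <= t <= 1 -> S (f t).
  move=> /andP[t0 t1]; have [->|tn1] := eqVneq t 1.
    by rewrite f1; exact: set_valP.
  have [|z _ zE] := h t; first by rewrite t0 lt_neqAle tn1.
  by rewrite /f -zE; exact: set_valP.
(* Outside [0, 1] the line may leave [S]; the default [x] then makes the map total. *)
have pE t : 0 <= t <= 1 -> set_val (insubd x (f t)) = f t.
  by move=> /fS /mem_set ?; exact: insubdK.
have pP t (z : S) : 0 <= t <= 1 -> set_val z = f t -> insubd x (f t) = z.
  by move=> t01 zt; apply: val_inj; rewrite -!set_valE pE.
exists (fun t => insubd x (f t)); split.
- apply: (@continuous_comp_initial _ _ _ (set_val : S -> _)).
  apply: (@subspace_eq_continuous _ _ _ (f : subspace _ -> _)).
    by move=> t; rewrite inE /= in_itv /= => /pE.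
  apply: continuous_subspaceT => t; apply: cvgD; apply: cvgZ.
  + by apply: cvgB; [exact: cvg_cst | exact: cvg_id].
  + exact: cvg_cst.
  + exact: cvg_id.
  + exact: cvg_cst.
- by apply: pP; rewrite ?lexx ?ler01.
- by apply: pP; rewrite ?lexx ?ler01.
- move=> r r01; have [z Gz zE] := h r r01.
  by rewrite (pP _ z) //; case/andP: r01 => -> /ltW.
Qed.

(** Going up, the segment enters the cell of [y] right after time 0; going down, it stays in the
    cell of [x] until time 1. *)
Lemma linked_cell_le (R : realType) (m : nat) (K : simplicial_complex R m)
    (G : set (cells K)) (x y : polyhedron K) :
  G (cell_of x) ->
  cell_le (cell_of x) (cell_of y) /\ G (cell_of y) \/
    cell_le (cell_of y) (cell_of x) ->
  linked R (G \o @cell_of R m K) x y.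
Proof.
move=> Gx xy; apply: linked_segment => t /andP[t0 t1].
have mk B c z : simplexes K B -> set_val c = cell B -> G c -> cell B z ->
    exists2 w : polyhedron K, G (cell_of w) & set_val w = z.
  move=> KB cB Gc Bz.
  have Kz : polyhedron K z by exists B => //; exact: cell_sub_hull.
  exists (SigSub (mem_set Kz)); last by rewrite set_valE.
  suff -> : cell_of (SigSub (mem_set Kz)) = c by [].
  by apply/cell_ofP; rewrite cB set_valE.
have [->|tn0] := eqVneq t 0.
  by exists x => //; rewrite subr0 scale1r scale0r addr0.
have xc : set_val (cell_of x) (set_val x) by apply/cell_ofP.
have yc : set_val (cell_of y) (set_val y) by apply/cell_ofP.
case: xy => [[[A [B [KA KB cA cB [_ AB]]]] Gy]|[A [B [KA KB cA cB [_ AB]]]]];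
  rewrite cA in xc yc; rewrite cB in xc yc.
  apply: (mk _ _ _ KB cB Gy); apply: cell_segment AB xc yc _.
  by rewrite lt0r tn0 t0 ltW.
apply: (mk _ _ _ KB cB Gx).
(* The larger cell is now at the start, so the segment is read backwards. *)
have := cell_segment AB yc xc (t := 1 - t).
by rewrite subKr [_ + (1 - t) *: _]addrC; apply; lra.
Qed.

(** * Connectedness and zigzags *)

(** Local constancy of [S] along [E] makes its trace on [E] both relatively open and relatively
    closed. *)
Lemma connected_near_iff (T : topologicalType) (E S : set T) (a : T) :
  connected E -> E a -> S a ->
  (forall t, E t -> \forall s \near t, E s -> (S t <-> S s)) ->
  E `<=` S.
Proof.
move=> cE Ea Sa loc; suff <- : E `&` S = E by move=> t [].
apply: cE; first by exists a.
- exists [set s | E s -> S s]°; first exact: open_interior.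
  apply/seteqP; split=> t [Et St]; split=> //.
    by apply: filterS (loc t Et) => s /[apply] -[+ _]; exact.
  exact: interior_subset St Et.
- exists (~` [set s | E s -> ~ S s]°).
    exact/open_closedC/open_interior.
  apply/seteqP; split=> t [Et St]; split=> //.
    by move=> /interior_subset /(_ Et).
  apply: contrapT => nSt; apply: St.
  by apply: filterS (loc t Et) => s /[apply] -[_ h] /h.
Qed.

(** [G] is imposed on the last world too, so that zigzags can be prolonged there. *)
Definition zigzag (PL : Type) (M : poset_model PL) (G : set M) (u v : M) :=
  exists (n : nat) (p : nat -> M),
    [/\ p 0%N = u, p n = v, forall i, (i <= n)%N -> G (p i) &
        forall i, (i < n)%N -> wle (p i) (p i.+1) \/ wle (p i.+1) (p i)].

Lemma zigzag_refl (PL : Type) (M : poset_model PL) (G : set M) (u : M) :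
  G u -> zigzag G u u.
Proof. by move=> Gu; exists 0%N, (fun=> u). Qed.

Lemma zigzag_step (PL : Type) (M : poset_model PL) (G : set M) (u v w : M) :
  zigzag G u v -> wle v w \/ wle w v -> G w -> zigzag G u w.
Proof.
move=> [n [p [pu pv Gp cp]]] vw Gw.
exists n.+1, (fun i => if (i <= n)%N then p i else w); split=> //.
- by rewrite ltnn.
- by move=> i _; case: ifP => // /Gp.
- move=> i; rewrite ltnS => lein; rewrite lein.
  case: ltnP => [/cp//|nlei].
  by have -> : i = n; [apply/eqP; rewrite eqn_leq lein | rewrite pv].
Qed.

(* A zigzag becomes a pm-path by repeating its first world and descending once
   at its end. *)
Lemma pm_path_zigzag (PL : Type) (M : poset_model PL) (G H : set M) (u : M) :
  (exists (l : nat) (p : nat -> M),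
     [/\ pm_path l p, p 0%N = u, H (p l) & forall i, (i < l)%N -> G (p i)]) <->
  (exists v w, [/\ zigzag G u v, wle w v & H w]).
Proof.
split.
- move=> [[|l] [p [[] //= l2 cp _ down pu Hp Gp]]].
  exists (p l), (p l.+1); split=> //.
  exists l, p; split=> // i il.
  by apply: cp; exact: leqW.
- move=> [v [w [[n [p [pu pv Gp cp]]] wv Hw]]].
  pose q i := if i is j.+1 then if (j <= n)%N then p j else w else u.
  exists n.+2, q; split=> //.
  + split=> //; last by rewrite /= ltnn leqnn pv.
      move=> [|i] /=; first by rewrite pu; left; exact: wle_refl.
      rewrite !ltnS => lein; rewrite lein; case: ltnP => [/cp//|nlei].
      by have -> : i = n; [apply/eqP; rewrite eqn_leq lein | rewrite pv; right].
    by rewrite /= pu; exact: wle_refl.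
  + by rewrite /= ltnn.
  + move=> [|i] /=; first by rewrite -pu => _; exact: Gp.
    by rewrite !ltnS => lein; rewrite lein; exact: Gp.
Qed.

(** * From topological paths to zigzags and back *)

Lemma path_zigzag (R : realType) (m : nat) (PL : Type)
    (P : polyhedral_model R m PL) (G : set (cell_poset_model P))
    (p : R -> polyhedron P) :
  {within `[0, 1], continuous p} ->
  (forall r, 0 <= r < 1 -> G (cell_of (p r))) ->
  exists2 v, zigzag G (cell_of (p 0)) v & cell_le (cell_of (p 1)) v.
Proof.
move=> cp Gp; pose c t := cell_of (p t).
have near_c (t : R) : 0 <= t <= 1 ->
    \forall s \near t, 0 <= s <= 1 -> cell_le (c t) (c s).
  move=> t01; have /subspace_continuousP/(_ t) := cp.
  rewrite /= in_itv /= => /(_ t01 _ (near_cell_le (p t))).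
  by apply: (@filterS _ _ (nbhs_filter t)) => s /=; rewrite in_itv.
pose S := [set t | zigzag G (c 0) (c t)].
have sub : [set t : R | 0 <= t < 1] `<=` S.
  apply: (@connected_near_iff _ _ _ 0).
  - apply/connected_intervalP => a b /= /andP[a0 _] /andP[_ b1] z /andP[az zb].
    by rewrite (le_trans a0 az) (le_lt_trans zb b1).
  - by rewrite /= lexx ltr01.
  - by apply: zigzag_refl; apply: Gp; rewrite lexx ltr01.
  - move=> t /= t01; have /near_c : 0 <= t <= 1 by lra.
    apply: (@filterS _ _ (nbhs_filter t)) => s cts s01.
    have {}cts : cell_le (c t) (c s) by apply: cts; lra.
    (* A zigzag step may go up or down, so one comparison serves both directions. *)
    by split=> z; apply: (zigzag_step z); [left|exact: Gp|right|exact: Gp].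
have [s /= [s01 cs]] : exists s, 0 <= s < 1 /\ cell_le (c 1) (c s).
  have h01 : (0 : R) <= 1 <= (1 : R) by rewrite ler01 lexx.
  have [e /= e0 eP] := near_c _ h01.
  (* Halving [e] puts the point strictly within [e] of 1, and the cap by 1 keeps it nonnegative. *)
  exists (1 - Num.min (e / 2) 1).
  have m0 : 0 < Num.min (e / 2) 1 by rewrite lt_min divr_gt0 ?ltr01.
  have me : Num.min (e / 2) 1 <= e / 2 by rewrite ge_min lexx.
  have m1 : Num.min (e / 2) 1 <= 1 by rewrite ge_min lexx orbT.
  split; first lra.
  apply: eP; last lra.
  by rewrite /ball_ /= subKr gtr0_norm //; lra.
by exists (c s) => //; exact: sub.
Qed.

Lemma cell_of_surj (R : realType) (m : nat) (K : simplicial_complex R m)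
    (c : cells K) : exists x : polyhedron K, cell_of x = c.
Proof.
have [A KA cA] := set_valP c; have [A0 _] := simplexesP KA.
have [z Az] := cell_nonempty A0.
have Kz : polyhedron K z by exists A => //; exact: cell_sub_hull.
by exists (SigSub (mem_set Kz)); apply/cell_ofP; rewrite -[set_val c]cA set_valE.
Qed.

(** Induction on the length with [y] generalized: the path runs to a point [w] of the last cell but
    one, then to a point [z] of the last cell, then down to [y]. *)
Lemma zigzag_linked (R : realType) (m : nat) (PL : Type)
    (P : polyhedral_model R m PL) (G : set (cell_poset_model P))
    (x y : polyhedron P) v :
  zigzag G (cell_of x) v -> cell_le (cell_of y) v ->
  linked R (G \o @cell_of R m P) x y.
Proof.
move=> [n [p [px <- Gp cp]]] yv.
elim: n => [|n IH] in y yv Gp cp *.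
  by apply: linked_cell_le; [rewrite -px; exact: Gp | right; rewrite -px].
have [z zE] := cell_of_surj (p n.+1).
have Gz : G (cell_of z) by rewrite zE; exact: Gp.
apply: (@linked_trans _ _ _ _ z); last first.
  by apply: linked_cell_le; rewrite ?zE; auto.
have [w wE] := cell_of_surj (p n).
have Gw : G (cell_of w) by rewrite wE; exact: Gp.
apply: (@linked_trans _ _ _ _ w).
  apply: IH => [|i lein|i ltin]; last by apply: cp; exact: leqW.
    by rewrite wE; exact: cell_le_refl.
  by apply: Gp; exact: leqW.
apply: linked_cell_le => //; rewrite wE zE.
by have [|] := cp n (ltnSn n); [left; split; [|rewrite -zE] | right].
Qed.

(** * Agreement of the two semantics *)

(** The valuation is a union of cells, and the one among them containing [x] is the cell of [x], by
    disjointness. *)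
Lemma pm_val_cell (R : realType) (m : nat) (PL : Type)
    (P : polyhedral_model R m PL) (p : PL) (x : polyhedron P) :
  pm_val P p (set_val x) <-> set_val (cell_of x) `<=` pm_val P p.
Proof.
split; last by apply; apply/cell_ofP.
have [A [KA -> Ax]] := cell_of_cell x.
have [C CK ->] := pm_valP P p; move=> [c Cc cx] y Ay.
exists c => //; have [B KB cB] := CK c Cc; rewrite -cB in cx *.
by rewrite -(cell_inj KA KB Ax cx).
Qed.

Theorem theorem3p20 (R : realType) (m : nat) (PL : Type)
    (P : polyhedral_model R m PL) (x : polyhedron P) (Phi : formula PL) :
  psat x Phi <-> @wsat PL (cell_poset_model P) (cell_of x) Phi.
Proof.
elim: Phi x => [p|g IHg|g IHg h IHh|g IHg h IHh] x /=.
- exact: pm_val_cell.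
- by split=> + /IHg.
- by split=> -[/IHg ? /IHh ?].
have pz := @pm_path_zigzag _ (cell_poset_model P) [set c | wsat c g]
  [set c | wsat c h] (cell_of x).
split.
- move=> [p [[cp p0] /IHh hp gp]]; apply/pz.
  have [r /gp/IHg //|v zv pv] := path_zigzag (G := [set c | wsat c g]) cp.
  by rewrite -p0; exists v, (cell_of (p 1)).
- move=> /pz[v [w [zv wv hw]]].
  (* Any point of the last cell can serve as the endpoint, and the induction hypothesis for [h]
     applies to it. *)
  have [y yw] := cell_of_surj w; subst w.
  have [p [cp p0 p1 gp]] := zigzag_linked zv wv.
  exists p; split=> //; first by rewrite p1; exact/IHh.
  by move=> r /gp/IHg.
Qed.
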